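(* Let $(u_h,q_h)(\cdot,t)\in Q_h\times Q_h$ be the solution of the semi-discrete DG scheme $$(u_{ht},\phi)=-A(q_h,\phi),\qquad (q_h,\psi)=A(u_h,\psi)\qquad\text{for all }\phi,\psi\in Q_h,$$ for $u_t=-(\partial_x^2+\partial_y^2)^2u$ on a rectangle $\Omega\subset\mathbb{R}^2$ with periodic boundary conditions. Then $$\frac12\frac{d}{dt}\iint_\Omega|u_h|^2\,dxdy=-\iint_\Omega q_h^2\,dxdy\le0 .$$
   Context: $\Omega$ is a rectangle partitioned into rectangular cells $I_{i,j}=[x_{i-1/2},x_{i+1/2}]\times[y_{j-1/2},y_{j+1/2}]$, $1\le i\le N$, $1\le j\le M$, uniform with sizes $\Delta x=x_{i+1/2}-x_{i-1/2}$, $\Delta y=y_{j+1/2}-y_{j-1/2}$. $Q_h=\{v\in L^2(\Omega): v|_{I_{i,j}}\in Q^k(I_{i,j})\}$, where $Q^k$ denotes tensor-product polynomials of degree at most $k$ in each variable. On a vertical interface $x=x_{i+1/2}$: $\{v\}=\frac12(v(x_{i+1/2}^-,y)+v(x_{i+1/2}^+,y))$, $[v]=v(x_{i+1/2}^+,y)-v(x_{i+1/2}^-,y)$, and analogously on horizontal interfaces $y=y_{j+1/2}$; traces from outside $\Omega$ on the boundary are taken by periodicity. $(\cdot,\cdot)$ is the $L^2(\Omega)$ inner product. The bilinear form is $$A(w,v)=\sum_{i,j=1}^{N,M}\iint_{I_{i,j}}\nabla w\cdot\nabla v\,dxdy+\sum_{i,j=1}^{N,M}\int_{y_{j-1/2}}^{y_{j+1/2}}\big(\{w_x\}[v]+\{v_x\}[w]\big)_{x_{i+1/2}}dy+\sum_{i,j=1}^{N,M}\int_{x_{i-1/2}}^{x_{i+1/2}}\big(\{w_y\}[v]+\{v_y\}[w]\big)_{y_{j+1/2}}dx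 .$$ *)

(* Defs.v *)
From HB Require Import structures.
From mathcomp Require Import all_boot all_order all_algebra.
From mathcomp Require Import all_classical all_reals all_analysis.

Set Implicit Arguments.
Unset Strict Implicit.
Unset Printing Implicit Defensive.

Import Order.TTheory GRing.Theory Num.Theory.
Import numFieldNormedType.Exports.

Local Open Scope classical_set_scope.
Local Open Scope ring_scope.

Record mesh (R : realType) := Mesh {
  ncols : nat;
  nrows : nat;
  xleft : R;
  ybottom : R;
  dx : R;
  dy : R;
  ncols_gt0 : (0 < ncols)%N;
  nrows_gt0 : (0 < nrows)%N;
  dx_gt0 : 0 < dx;
  dy_gt0 : 0 < dy }.

Section DG.
Variables (R : realType) (G : mesh R).

Definition area := (@lebesgue_measure R \x @lebesgue_measure R)%E.

(* Cells are numbered from 0: cell (i, j) here is I_{i+1,j+1}, and xgrid i is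
   the abscissa x_{i+1/2}, so that the left and right edges of cell (i, j) are
   xgrid i and xgrid i.+1. *)
Definition xgrid (i : nat) : R := xleft G + i%:R * dx G.
Definition ygrid (j : nat) : R := ybottom G + j%:R * dy G.

Definition Omega : set (R * R) :=
  `[xgrid 0, xgrid (ncols G)] `*` `[ygrid 0, ygrid (nrows G)].

Definition cell (i j : nat) : set (R * R) :=
  `[xgrid i, xgrid i.+1] `*` `[ygrid j, ygrid j.+1].

Definition open_cell (i j : nat) : set (R * R) :=
  `]xgrid i, xgrid i.+1[ `*` `]ygrid j, ygrid j.+1[.

Definition in_L2 (v : R * R -> R) : Prop := v \_ Omega \in Lfun area 2%:E.

(* The polynomial condition is imposed on open cells only, because an element
   of Q_h is in general two-valued on the interfaces.  The values of v on the
   mesh skeleton, a null set, are irrelevant. *)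
Definition Qh (k : nat) (v : R * R -> R) : Prop :=
  in_L2 v /\
  forall (i : 'I_(ncols G)) (j : 'I_(nrows G)),
    exists c : 'M[R]_k.+1, forall z, open_cell i j z ->
      v z = \sum_(a < k.+1) \sum_(b < k.+1) c a b * z.1 ^+ a * z.2 ^+ b.

Definition L2dot (v w : R * R -> R) : R := \int[area]_(z in Omega) (v z * w z).

Definition ddx (v : R * R -> R) (z : R * R) : R := 'D_(1, 0) (v : R * R -> R^o) z.
Definition ddy (v : R * R -> R) (z : R * R) : R := 'D_(0, 1) (v : R * R -> R^o) z.

(* One-sided traces on the interface x = xgrid i.+1.  The reduction modulo the
   number of columns replaces the outer trace at the right end of Omega by the
   trace from the right at its left end (periodicity). *)
Definition xtraceL (v : R * R -> R) (i : nat) (y : R) : R :=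
  lim (v (x, y) @[x --> (xgrid i.+1)^'-]).
Definition xtraceR (v : R * R -> R) (i : nat) (y : R) : R :=
  lim (v (x, y) @[x --> (xgrid (i.+1 %% ncols G))^'+]).
Definition xavg v i y : R := 2^-1 * (xtraceL v i y + xtraceR v i y).
Definition xjump v i y : R := xtraceR v i y - xtraceL v i y.

Definition ytraceL (v : R * R -> R) (j : nat) (x : R) : R :=
  lim (v (x, y) @[y --> (ygrid j.+1)^'-]).
Definition ytraceR (v : R * R -> R) (j : nat) (x : R) : R :=
  lim (v (x, y) @[y --> (ygrid (j.+1 %% nrows G))^'+]).
Definition yavg v j x : R := 2^-1 * (ytraceL v j x + ytraceR v j x).
Definition yjump v j x : R := ytraceR v j x - ytraceL v j x.

Definition Aform (w v : R * R -> R) : R :=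
  \sum_(i < ncols G) \sum_(j < nrows G)
    \int[area]_(z in cell i j) (ddx w z * ddx v z + ddy w z * ddy v z)
  + \sum_(i < ncols G) \sum_(j < nrows G)
      \int[lebesgue_measure]_(y in `[ygrid j, ygrid j.+1])
        (xavg (ddx w) i y * xjump v i y + xavg (ddx v) i y * xjump w i y)
  + \sum_(i < ncols G) \sum_(j < nrows G)
      \int[lebesgue_measure]_(x in `[xgrid i, xgrid i.+1])
        (yavg (ddy w) j x * yjump v j x + yavg (ddy v) j x * yjump w j x).

(* ut is the derivative at time t of the curve s |-> u s in the
   finite-dimensional space Q_h; convergence there amounts to pointwise
   convergence inside the cells. *)
Definition time_derivative (k : nat) (u : R -> R * R -> R) (t : R)
    (ut : R * R -> R) : Prop :=
  Qh k ut /\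
  forall (i : 'I_(ncols G)) (j : 'I_(nrows G)) z, open_cell i j z ->
    is_derive t (1 : R) (fun s => u s z : R^o) (ut z).

Definition dg_solution (k : nat) (J : set R) (u q : R -> R * R -> R) : Prop :=
  forall t, J t ->
    [/\ Qh k (u t), Qh k (q t) &
     exists ut, [/\ time_derivative k u t ut,
       forall phi, Qh k phi -> L2dot ut phi = - Aform (q t) phi &
       forall psi, Qh k psi -> L2dot (q t) psi = Aform (u t) psi]].

End DG.

Arguments area R : clear implicits.

(* Main.v *)
(* Testing the first equation with u_h and the second with q_h gives
   (u_ht, u_h) = - A(q_h, u_h) = - A(u_h, q_h) = - (q_h, q_h), since A is
   symmetric.  That (u_ht, u_h) is half the derivative of the energy is not
   immediate, because u_ht is only a pointwise derivative inside the cells.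
   Expanding in the Lagrange basis of each cell, the coefficients of an element
   of Q_h are its values at interior nodes, so the L2 product on Q_h is a fixed
   bilinear form in finitely many point values, each of which is differentiable
   in time. *)
Require Import Defs.
From HB Require Import structures.
From mathcomp Require Import all_boot all_order all_algebra.
From mathcomp Require Import all_classical all_reals all_analysis.
From mathcomp Require Import measurable_realfun qpoly ring.

Import Order.TTheory GRing.Theory Num.Theory.
Import numFieldNormedType.Exports.

Local Open Scope classical_set_scope.
Local Open Scope ring_scope.

(** * Lagrange bases on the cells of a uniform grid in one variable *)

Section NodalBasis1D.
Context {R : realType}.
Variables (a h : R) (k : nat).
Hypothesis h0 : 0 < h.

Definition grid (i : nat) : R := a + i%:R * h.

(* Infinitely many points, because [lagrange] wants an injective sequence; only
   the first k+1 of them serve as nodes. *)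
Definition cell_node (i m : nat) : R := grid i + h / m.+2%:R.

(** The indicator extends the Lagrange polynomial by zero off its open cell, so that a sum over the
    nodes of all cells reduces to the cell containing [x]. *)
Definition shape1 (i : nat) (m : 'I_k.+1) (x : R) : R :=
  \1_(`]grid i, grid i.+1[%classic) x *
  ((tnth (lagrange k.+1 (cell_node i)) m : {poly R})).[x].

Lemma gridS i : grid i.+1 = grid i + h.
Proof. by rewrite /grid -natr1; ring. Qed.

Lemma grid_lt i j : (grid i < grid j) = (i < j)%N.
Proof. by rewrite ltrD2l ltr_pM2r// ltr_nat. Qed.

Lemma cell_node_inj i : injective (cell_node i).
Proof.
move=> m n /addrI /(mulfI (lt0r_neq0 h0)) /invr_inj /eqP.
by rewrite eqr_nat => /eqP [].
Qed.

Lemma cell_node_in i m : `]grid i, grid i.+1[%classic (cell_node i m).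
Proof.
rewrite /= in_itv /= gridS /cell_node ltrDl ltrD2l divr_gt0//=.
by rewrite ltr_pdivrMr// ltr_pMr// ltr1n.
Qed.

Lemma open_cell_disjoint {i j x} : `]grid i, grid i.+1[%classic x ->
  `]grid j, grid j.+1[%classic x -> i = j.
Proof.
rewrite /= !in_itv /= => /andP[ix xi] /andP[jx xj].
have := lt_trans ix xj; have := lt_trans jx xi.
by rewrite !grid_lt !ltnS => ji ij; apply/eqP; rewrite eqn_leq ij ji.
Qed.

(** Induction on [n], cutting at [grid n]. In two variables this places the points of [Omega]
    outside every open cell on grid lines. *)
Lemma grid_cover n x : `[grid 0, grid n]%classic x ->
  (exists i, x = grid i) \/ exists i : 'I_n, `]grid i, grid i.+1[%classic x.
Proof.
elim: n => [|n IHn] /=; rewrite in_itv /=.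
  by move=> /le_anti <-; left; exists 0%N.
move=> /andP[x0 xn]; have [xn'|nx] := leP x (grid n).
  case: IHn => [|[i ->]|[i xi]]; first by rewrite /= in_itv /= x0.
    by left; exists i.
  by right; exists (widen_ord (leqnSn n) i).
move: xn; rewrite le_eqVlt => /orP[/eqP ->|xn]; first by left; exists n.+1.
by right; exists ord_max; rewrite /= in_itv /= nx.
Qed.

Lemma shape1_out i m x : ~ `]grid i, grid i.+1[%classic x -> shape1 i m x = 0.
Proof. by move=> xi; rewrite /shape1 indicE memNset// mul0r. Qed.

(** Lagrange interpolation at [k.+1] distinct nodes reproduces polynomials of degree at most [k], in
    particular ['X^p]. *)
Lemma monomial_nodal i (p : 'I_k.+1) x : `]grid i, grid i.+1[%classic x ->
  x ^+ p = \sum_(m < k.+1) cell_node i m ^+ p * shape1 i m x.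
Proof.
move=> xi.
have := @lagrange_gen R k.+1 (cell_node i) isT (cell_node_inj i) 'X^p.
rewrite size_polyXn ltn_ord => /(_ isT) /(congr1 (horner^~ x)).
rewrite hornerXn horner_sum => ->; apply: eq_bigr => m _.
by rewrite /shape1 indicE mem_set// mul1r hornerM hornerC hornerXn.
Qed.

Lemma shape1_bounded i m : exists B, forall x, `|shape1 i m x| <= B.
Proof.
have [B HB] := poly_itv_bound (tnth (lagrange k.+1 (cell_node i)) m : {poly R})
  (grid i) (grid i.+1).
(* The absolute value makes the bound nonnegative, as required off the cell, where [shape1]
   vanishes. *)
exists `|B| => x; rewrite /shape1 indicE.
have [|_] := boolP (x \in _); last by rewrite mul0r normr0.
rewrite inE /= in_itv /= mul1r => /andP[ix xi].
by apply: (le_trans (HB x _)); rewrite ?ler_norm// !ltW.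
Qed.

Lemma measurable_shape1 i m : measurable_fun setT (shape1 i m).
Proof.
apply: measurable_funM => //.
exact: measurable_poly.
Qed.

End NodalBasis1D.

(** * Finite sums under integrals and derivatives *)

Lemma Rintegral_sum d (T : measurableType d) (R : realType)
    (mu : {measure set T -> \bar R}) (D : set T) (I : Type) (s : seq I)
    (f : I -> T -> R) : measurable D ->
  (forall i, mu.-integrable D (EFin \o f i)) ->
  \int[mu]_(x in D) (\sum_(i <- s) f i x) = \sum_(i <- s) \int[mu]_(x in D) f i x.
Proof.
move=> mD intf; elim: s => [|i s IHs].
  under eq_Rintegral do rewrite big_nil.
  by rewrite Rintegral_cst// mul0r big_nil.
under eq_Rintegral do rewrite big_cons.
rewrite big_cons -IHs RintegralD//.
rewrite (_ : _ \o _ = fun x => (\sum_(j <- s) (f j x)%:E)%E).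
  by apply: integrable_sum => // i' _; exact: intf.
by apply/funext => x /=; rewrite sumEFin.
Qed.

Lemma is_derive_bigsum (R : realType) (I : finType) (f : I -> R -> R)
    (df : I -> R) (t : R) :
  (forall i, is_derive t 1 (f i : R -> R^o) (df i)) ->
  is_derive t 1 (fun s => \sum_i f i s : R^o) (\sum_i df i).
Proof.
move=> dfi; rewrite -[X in is_derive _ _ X]fct_sumE.
elim/big_ind2 : _ => //.
- exact: is_derive_cst.
- by move=> F1 d1 F2 d2 *; exact: is_deriveD.
Qed.

(** * Tensor-product nodal basis of [Qh], and the derivative of the energy *)

Section NodalBasis.
Context {R : realType}.
Variables (G : mesh R) (k : nat).

Definition nodal_index := ('I_(ncols G) * 'I_(nrows G) * ('I_k.+1 * 'I_k.+1))%type.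

Definition node (I : nodal_index) : R * R :=
  (cell_node (xleft G) (dx G) I.1.1 I.2.1, cell_node (ybottom G) (dy G) I.1.2 I.2.2).

Definition shape (I : nodal_index) (z : R * R) : R :=
  shape1 (xleft G) (dx G) k I.1.1 I.2.1 z.1 *
  shape1 (ybottom G) (dy G) k I.1.2 I.2.2 z.2.

Definition gram (I J : nodal_index) : R := L2dot G (shape I) (shape J).

Lemma node_in (I : nodal_index) : open_cell G I.1.1 I.1.2 (node I).
Proof. by split; apply: cell_node_in; [exact: dx_gt0|exact: dy_gt0]. Qed.

(** Each monomial of the cell polynomial is expanded by [monomial_nodal] in both variables.
    Collecting the coefficients of one shape function gives back the cell polynomial at its node. *)
Lemma Qh_nodal v (i : 'I_(ncols G)) (j : 'I_(nrows G)) z :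
  Qh G k v -> open_cell G i j z -> v z = \sum_I v (node I) * shape I z.
Proof.
move=> [_ vpoly] zij; have [zi zj] := zij; have [c vE] := vpoly i j.
have -> : \sum_I v (node I) * shape I z =
    \sum_(mn : 'I_k.+1 * 'I_k.+1) v (node ((i, j), mn)) * shape ((i, j), mn) z.
  rewrite -(pair_bigA _ (fun ij mn => v (node (ij, mn)) * shape (ij, mn) z)) /=.
  rewrite (bigD1 (i, j))//= [X in _ + X]big1 ?addr0// => -[i' j'] ij'.
  apply: big1 => mn _; rewrite /shape /=.
  (* Another cell differs in its column or in its row, so one factor of its shape functions vanishes
     at [z]. *)
  have [i'i|/eqP i'i] := eqVneq i' i; last first.
    rewrite (@shape1_out _ _ _ _ i') ?mul0r ?mulr0// => zi'; apply: i'i.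
    by apply/val_inj; exact: (open_cell_disjoint _ _ (dx_gt0 G) zi' zi).
  have [j'j|/eqP j'j] := eqVneq j' j; first by rewrite i'i j'j eqxx in ij'.
  rewrite (@shape1_out _ _ _ _ j') ?mulr0// => zj'; apply: j'j.
  by apply/val_inj; exact: (open_cell_disjoint _ _ (dy_gt0 G) zj' zj).
rewrite vE// -(pair_bigA _ (fun m n =>
  v (node ((i, j), (m, n))) * shape ((i, j), (m, n)) z)) /=.
transitivity (\sum_(p < k.+1) \sum_(r < k.+1) \sum_(m < k.+1) \sum_(n < k.+1)
   c p r * (node ((i, j), (m, n))).1 ^+ p * (node ((i, j), (m, n))).2 ^+ r
   * shape ((i, j), (m, n)) z).
  apply: eq_bigr => p _; apply: eq_bigr => r _.
  rewrite (monomial_nodal _ _ _ (dx_gt0 G) i p _ zi).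
  rewrite (monomial_nodal _ _ _ (dy_gt0 G) j r _ zj).
  rewrite -mulrA mulr_suml mulr_sumr; apply: eq_bigr => m _.
  by rewrite !mulr_sumr; apply: eq_bigr => n _; rewrite /shape /=; ring.
under [LHS]eq_bigr => p _ do rewrite exchange_big.
rewrite [LHS]exchange_big; apply: eq_bigr => m _ /=.
under [LHS]eq_bigr => p _ do rewrite exchange_big.
rewrite [LHS]exchange_big; apply: eq_bigr => n _ /=.
(* The cell polynomial takes the value of [v] here because the node is interior to the cell. *)
rewrite vE; last exact: (node_in ((i, j), (m, n))).
by rewrite mulr_suml; apply: eq_bigr => p _; rewrite mulr_suml.
Qed.

Lemma measurable_Omega : measurable (Omega G).
Proof. by apply: measurableX. Qed.

Lemma area_Omega_lty : (area R (Omega G) < +oo)%E.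
Proof.
rewrite /area /Omega product_measure1E//= !lebesgue_measure_itv /=.
by do 2 case: ifP => _; rewrite -?EFinB -?EFinM ?mul0e ?mule0 ?ltry.
Qed.

Lemma area_vline_negligible c : (area R).-negligible ([set c] `*` [set: R]).
Proof.
exists ([set c] `*` [set: R]); split => //; first exact: measurableX.
by rewrite /area product_measure1E//= lebesgue_measure_set1 mul0e.
Qed.

Lemma area_hline_negligible c : (area R).-negligible ([set: R] `*` [set c]).
Proof.
exists ([set: R] `*` [set c]); split => //; first exact: measurableX.
by rewrite /area product_measure1E//= lebesgue_measure_set1 mule0.
Qed.

Lemma ae_open_cell : {ae area R, forall z, Omega G z ->
  exists (i : 'I_(ncols G)) (j : 'I_(nrows G)), open_cell G i j z}.
Proof.
(* Grid lines of all natural indices are taken, even beyond the mesh: a countable union of null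
   lines is null. *)
have skeleton0 : (area R).-negligible
    ((\bigcup_i ([set xgrid G i] `*` [set: R])) `|`
     \bigcup_j ([set: R] `*` [set ygrid G j])).
  by apply: negligibleU; apply: negligible_bigcup => i;
    [exact: area_vline_negligible|exact: area_hline_negligible].
apply: negligibleS skeleton0 => z /= /not_implyP[[zx zy]] zcell.
have [[i zi]|[i zi]] := grid_cover _ _ _ _ zx; first by left; exists i.
have [[j zj]|[j zj]] := grid_cover _ _ _ _ zy; first by right; exists j.
by exfalso; apply: zcell; exists i, j.
Qed.

Lemma measurable_shape I : measurable_fun setT (shape I).
Proof.
apply: measurable_funM.
  apply: (measurableT_comp (measurable_shape1 _ _ _ _ _)); exact: measurable_fst.
apply: (measurableT_comp (measurable_shape1 _ _ _ _ _)); exact: measurable_snd.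
Qed.

(** A bounded measurable function is integrable on a set of finite area. *)
Lemma integrable_shapeM I J :
  (area R).-integrable (Omega G) (EFin \o (fun z => shape I z * shape J z)).
Proof.
apply: measurable_bounded_integrable.
- exact: measurable_Omega.
- exact: area_Omega_lty.
- by apply: measurable_funTS; apply: measurable_funM; exact: measurable_shape.
have [B1 HB1] := shape1_bounded (xleft G) (dx G) k I.1.1 I.2.1.
have [B2 HB2] := shape1_bounded (ybottom G) (dy G) k I.1.2 I.2.2.
have [B3 HB3] := shape1_bounded (xleft G) (dx G) k J.1.1 J.2.1.
have [B4 HB4] := shape1_bounded (ybottom G) (dy G) k J.1.2 J.2.2.
exists ((B1 * B2) * (B3 * B4)); split; first exact: num_real.
move=> y /ltW By z _ /=; apply: le_trans By.
by rewrite normrM ler_pM// /shape normrM ler_pM.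
Qed.

Lemma in_L2_measurable v : in_L2 G v -> measurable_fun (Omega G) v.
Proof.
rewrite /in_L2 inE => /andP[+ _]; rewrite inE /=.
by move/(measurable_restrictT _ measurable_Omega).
Qed.

Lemma L2dot_nodal v w : Qh G k v -> Qh G k w ->
  L2dot G v w = \sum_I \sum_J gram I J * (v (node I) * w (node J)).
Proof.
move=> Qv Qw; rewrite /L2dot.
(* The values on the skeleton are arbitrary, so measurability comes from the L2 condition and not
   from the cell polynomials. *)
have mv := in_L2_measurable v Qv.1; have mw := in_L2_measurable w Qw.1.
have intg (p : nodal_index * nodal_index) : (area R).-integrable (Omega G)
    (EFin \o (fun z => v (node p.1) * w (node p.2) * (shape p.1 z * shape p.2 z))).
  have := integrableZl (mu := area R) measurable_Omega (v (node p.1) * w (node p.2))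
    (integrable_shapeM p.1 p.2).
  by congr (integrable _ _ _); apply/funext => z; rewrite /= EFinM.
(* The double sum is flattened to one sum over pairs, to be exchanged with the integral in one
   go. *)
transitivity (\int[area R]_(z in Omega G) \sum_(p : nodal_index * nodal_index)
    (v (node p.1) * w (node p.2) * (shape p.1 z * shape p.2 z))).
  congr fine; apply: ae_eq_integral.
  - exact: measurable_Omega.
  - by apply/measurable_EFinP; exact: measurable_funM.
  - apply/measurable_EFinP; apply: measurable_sum => p.
    by have /measurable_int/measurable_EFinP := intg p.
  - apply: negligibleS ae_open_cell; apply: subsetC => z /= zcell /zcell[i [j zij]].
    congr EFin.
    rewrite (Qh_nodal _ _ _ _ Qv zij) (Qh_nodal _ _ _ _ Qw zij).
    rewrite mulr_suml -(pair_bigA _ (fun I J =>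
      v (node I) * w (node J) * (shape I z * shape J z))) /=.
    by apply: eq_bigr => I _; rewrite mulr_sumr; apply: eq_bigr => J _; ring.
rewrite Rintegral_sum//; last exact: measurable_Omega.
rewrite pair_bigA /=; apply: eq_bigr => -[I J] _ /=.
rewrite [RHS]mulrC; apply: (RintegralZl (mu := area R)).
  exact: measurable_Omega.
exact: integrable_shapeM.
Qed.

Lemma L2dotC v w : L2dot G v w = L2dot G w v.
Proof. by apply: eq_Rintegral => z _; rewrite mulrC. Qed.

(** Symmetry holds integrand by integrand: products commute in the cell terms, and exchanging [w]
    and [v] swaps the two summands in the interface terms. *)
Lemma AformC w v : Aform G w v = Aform G v w.
Proof.
rewrite /Aform; apply: f_equal2; first apply: f_equal2.
- apply: eq_bigr => i _; apply: eq_bigr => j _; apply: eq_Rintegral => z _.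
  by rewrite (mulrC (ddx w z)) (mulrC (ddy w z)).
- apply: eq_bigr => i _; apply: eq_bigr => j _; apply: eq_Rintegral => y _.
  by rewrite addrC.
- apply: eq_bigr => j _; apply: eq_bigr => i _; apply: eq_Rintegral => x _.
  by rewrite addrC.
Qed.

Lemma is_derive_L2dot (J : set R) (u : R -> R * R -> R) t ut :
  open J -> J t -> (forall s, J s -> Qh G k (u s)) -> time_derivative G k u t ut ->
  is_derive t 1 (fun s => L2dot G (u s) (u s)) (2 * L2dot G ut (u t)).
Proof.
move=> oJ Jt Qu [Qut du]; have Qt := Qu t Jt.
pose c I s := u s (node I).
have dc I : is_derive t 1 (c I : R -> R^o) (ut (node I)) by exact/du/node_in.
apply: (@near_eq_is_derive _ _ _ (fun s => \sum_I \sum_J gram I J * (c I s * c J s))).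
  (* The nodal formula is available only at times in [J], which is a neighbourhood of [t] because it
     is open. *)
  near=> s; rewrite L2dot_nodal//; apply: Qu; near: s; exact: open_nbhs_nbhs.
have -> : 2 * L2dot G ut (u t) = \sum_I \sum_J gram I J *
    (c I t * ut (node J) + c J t * ut (node I)).
  (* Taking the product once in each order yields the two terms of the product rule directly,
     without transposing [gram]. *)
  have -> : 2 * L2dot G ut (u t) = L2dot G (u t) ut + L2dot G ut (u t).
    by rewrite [L2dot G (u t) _]L2dotC; ring.
  rewrite !L2dot_nodal// -big_split; apply: eq_bigr => I _ /=.
  by rewrite -big_split; apply: eq_bigr => I' _; rewrite /c /=; ring.
by apply: is_derive_bigsum => I; apply: is_derive_bigsum.
Unshelve. all: by end_near. Qed.

End NodalBasis.

Theorem theorem3p1 (R : realType) (G : mesh R) (k : nat) (J : set R)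
    (u q : R -> R * R -> R) (hJ : open J) (huq : dg_solution G k J u q)
    (t : R) (ht : J t) :
  let energy := fun s : R => \int[area R]_(z in Omega G) (`|u s z| ^+ 2) in
  let dissipation := \int[area R]_(z in Omega G) (q t z ^+ 2) in
  [/\ derivable energy t 1,
      2^-1 * (energy^`())%classic t = - dissipation &
      - dissipation <= 0].
Proof.
move=> energy dissipation.
have [Qut Qqt [ut [dut uE qE]]] := huq t ht.
(* Membership is recorded at all times of [J], since differentiating the energy involves times near
   [t]. *)
have Qu s : J s -> Qh G k (u s) by case/huq.
have energyE : energy = fun s => L2dot G (u s) (u s).
  apply/funext => s; apply: eq_Rintegral => z _.
  by rewrite real_normK ?num_real// expr2.
have dissipationE : dissipation = L2dot G (q t) (q t).
  by apply: eq_Rintegral => z _; rewrite expr2.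
have dE : is_derive t 1 energy (- (2 * dissipation)).
  rewrite energyE; apply: is_derive_eq.
    exact: (is_derive_L2dot _ _ _ _ _ _ hJ ht Qu dut).
  by rewrite uE// AformC -qE// -dissipationE mulrN.
split.
- exact: ex_derive.
- by rewrite derive1E derive_val mulrN mulrA mulVf ?mul1r// pnatr_eq0.
- by rewrite oppr_le0; apply: Rintegral_ge0 => z _; exact: sqr_ge0.
Qed.
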